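(* A join space is projective if and only if it is dense and join-equivalence-relational.
   Context: A join space is a set $X$ with a ternary relation $\langle\cdot,\cdot,\cdot\rangle$ on $X$ such that: $\langle a,x,x\rangle$ for all $a,x\in X$; $\langle x,b,y\rangle$ implies $\langle y,b,x\rangle$ for all $x,b,y\in X$; and $\langle x,y,x\rangle$ implies $y=x$ for all $x,y\in X$. For $a,c\in X$ put $ac:=\{x\in X\mid\langle a,x,c\rangle\}$. For $A\subseteq X$ and $x,y\in X$, $\langle A,x,y\rangle$ means that there is $a\in A$ with $\langle a,x,y\rangle$. For $A\subseteq X$: $X$ is $A$-transitive iff the binary relation $\langle A,\cdot,\cdot\rangle$ is transitive on $X$. $X$ is $A$-symmetric iff the binary relation $\langle A,\cdot,\cdot\rangle$ is symmetric on $X\setminus A$. $X$ is $A$-equivalence-relational iff it is $A$-transitive and $A$-symmetric. $X$ is equivalence-relational iff it is $\{a\}$-equivalence-relational for every $a\in X$. $X$ is join-equivalence-relational iff for all $a,b\in X$ it is $ab$-equivalence-relational. $X$ is preprojective iff it is equivalence-relational and for all $a,b,c,d\in X$: if $b=c$ or $a=d$ or $bc\cap ad\neq\emptyset$, then $a=b$ or $c=d$ or $ab\cap cd\neq\emptyset$. $X$ is dense iff for all $a,b\in X$ with $a\neq b$, $ab\setminus\{a,b\}\neq\emptyset$. $X$ is projective iff it is preprojective and dense. *)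

(* Defs.v *)
From Stdlib Require Import Relation_Definitions.
From mathcomp Require Import all_boot.
From mathcomp Require Import classical_sets.

Set Implicit Arguments.
Unset Strict Implicit.
Unset Printing Implicit Defensive.

Local Open Scope classical_set_scope.

(* [btw a x c] is the relation <a, x, c>, with the middle argument thought of
   as lying between the outer two. *)
Record joinSpace : Type := JoinSpace {
  carrier :> Type;
  btw : carrier -> carrier -> carrier -> Prop;
  btw_refl : forall a x : carrier, btw a x x;
  btw_sym : forall x b y : carrier, btw x b y -> btw y b x;
  btw_eq : forall x y : carrier, btw x y x -> y = x
}.

Section JoinSpace.
Variable X : joinSpace.
Implicit Types (a b c d x y : X) (A : set X).

Definition join a c : set X := [set x | btw a x c].

Definition btw_set A x y : Prop := exists2 a, A a & btw a x y.

(* Qualified: ssrbool's [transitive] is about boolean relations. *)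
Definition set_transitive A : Prop :=
  Relation_Definitions.transitive X (btw_set A).

Definition set_symmetric A : Prop :=
  forall x y, (~` A) x -> (~` A) y -> btw_set A x y -> btw_set A y x.

Definition set_equivalence_relational A : Prop :=
  set_transitive A /\ set_symmetric A.

Definition equivalence_relational : Prop :=
  forall a, set_equivalence_relational [set a].

Definition join_equivalence_relational : Prop :=
  forall a b, set_equivalence_relational (join a b).

Definition preprojective : Prop :=
  equivalence_relational /\
  forall a b c d,
    b = c \/ a = d \/ join b c `&` join a d !=set0 ->
    a = b \/ c = d \/ join a b `&` join c d !=set0.

Definition dense : Prop :=
  forall a b, a <> b -> join a b `\` [set a; b] !=set0.

Definition projective : Prop := preprojective /\ dense.

End JoinSpace.

Arguments equivalence_relational X : clear implicits.
Arguments join_equivalence_relational X : clear implicits.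
Arguments preprojective X : clear implicits.
Arguments dense X : clear implicits.
Arguments projective X : clear implicits.

(* Main.v *)
Require Import Defs.
From mathcomp Require Import all_boot boolp classical_sets.

(** In an equivalence-relational join space the joins behave like the lines of
    a projective space: a line is determined by any two of its points.  The
    Veblen-type axiom then says exactly that [<ab, _, _>] is transitive: a
    chain [x] in [py], [y] in [qz] with [p], [q] in [ab] makes [qz] and [px] meet
    (in [y]), so [pq] and [zx] meet, which exhibits [x] as a point of [rz] with
    [r] in [ab]; and conversely.  The symmetry of [<ab, _, _>] off [ab] is
    already the symmetry of [<p, _, _>] for each [p] in [ab]. *)

Set Implicit Arguments.
Unset Strict Implicit.
Unset Printing Implicit Defensive.

Local Open Scope classical_set_scope.

Section JoinSpaceTheory.
Variable X : joinSpace.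
Implicit Types (a b c d p q r t x y z : X).

Lemma btw_left a c : btw a a c.
Proof. exact/btw_sym/btw_refl. Qed.

Lemma join_diag a : join a a = [set a].
Proof.
by apply/seteqP; split=> x /= => [/btw_eq|->]; last exact: btw_left.
Qed.

Lemma btw_set1 a x y : btw_set [set a] x y <-> btw a x y.
Proof. by split=> [[_ ->]|axy] //; exists a. Qed.

Lemma join_equivalence_relationalW :
  join_equivalence_relational X -> equivalence_relational X.
Proof. by move=> jX a; rewrite -join_diag; apply: jX. Qed.

Section Lines.
Hypothesis erX : equivalence_relational X.

Lemma btw_trans a x y z : btw a x y -> btw a y z -> btw a x z.
Proof.
move=> /btw_set1 axy /btw_set1 ayz; apply/btw_set1.
exact: (erX a).1 axy ayz.
Qed.

Lemma btw_exchange a x y : x <> a -> btw a x y -> btw a y x.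
Proof.
move=> xNa axy; apply/btw_set1; apply: (erX a).2 => //=; last exact/btw_set1.
(* Symmetry is only given off [a], but [y = a] would make [btw a x a], forcing [x = a]. *)
by move=> ya; apply: xNa; apply: btw_eq; rewrite -{2}ya.
Qed.

(** For [p] other than [a], exchange puts [b] in [ap], hence [q] too. Transitivity based at [p] then
    puts [t] in [pa], and transitivity based at [a] carries it to [ab]. *)
Lemma join_subset a b p q :
  join a b p -> join a b q -> join p q `<=` join a b.
Proof.
rewrite /join /= => apb aqb t /= ptq.
have [pa|pNa] := pselect (p = a).
  by apply: btw_trans aqb; rewrite -pa.
have aqp := btw_trans aqb (btw_exchange pNa apb).
apply: btw_trans apb; apply: btw_sym; apply: btw_trans ptq _.
exact: btw_sym.
Qed.

Lemma join_symmetric a b : set_symmetric (join a b).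
Proof.
move=> x y xNab _ [p abp pxy]; exists p => //.
by apply: btw_exchange pxy => xp; apply: xNab; rewrite xp.
Qed.

End Lines.

Lemma preprojective_join_transitive a b :
  preprojective X -> set_transitive (join a b).
Proof.
move=> [erX veblen] x y z [p abp pxy] [q abq qyz].
have [xp|xNp] := pselect (x = p).
  by exists x; [rewrite xp | exact: btw_left].
have meet : join q z `&` join p x !=set0.
  by exists y; split=> //; apply: btw_exchange.
have [pq|[zx|[r [pqr zrx]]]] : p = q \/ z = x \/ join p q `&` join z x !=set0.
- by apply: veblen; right; right.
- by exists p => //; apply: (btw_trans erX pxy); rewrite pq.
- by exists p => //; rewrite zx; apply: btw_refl.
have abr : join a b r := join_subset erX abp abq pqr.
have [rz|rNz] := pselect (r = z); last first.
  by exists r => //; apply/btw_sym/(btw_exchange erX rNz).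
(* Now [z] is in [ab], hence so are [y] in [qz] and [x] in [py]: [x] is its own witness. *)
exists x; last exact: btw_left.
have aby : join a b y by apply: (join_subset erX abq _ qyz); rewrite -rz.
exact: (join_subset erX abp aby pxy).
Qed.

Lemma join_equivalence_relational_preprojective :
  join_equivalence_relational X -> preprojective X.
Proof.
move=> jX; have erX := join_equivalence_relationalW jX.
split=> // a b c d meet.
have [|aNb] := pselect (a = b); first by left.
have [|cNd] := pselect (c = d); first by right; left.
right; right; case: meet => [->|[->|[p [bpc apd]]]].
- by exists c; split; [exact: btw_refl | exact: btw_left].
- by exists d; split; [exact: btw_left | exact: btw_refl].
have [pa|pNa] := pselect (p = a).
  (* Here [a] lies in [bc], so exchange based at [b] puts [c] in [ab]. *)
  exists c; split; last exact: btw_left.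
  apply: btw_sym; have bac : btw b a c by rewrite -pa.
  exact: btw_exchange.
(* The chain [d] in [ap], [p] in [bc] starts from two points of [ab]. Transitivity yields [r] in
   [ab] with [d] in [rc], and exchange based at [c] puts [r] in [cd]. *)
have abdp : btw_set (join a b) d p.
  by exists a; [exact: btw_left | exact: btw_exchange].
have abpc : btw_set (join a b) p c by exists b => //; exact: btw_refl.
have [r abr rdc] := (jX a b).1 _ _ _ abdp abpc.
exists r; split=> //; apply: btw_exchange => //; first exact/nesym.
exact: btw_sym.
Qed.

End JoinSpaceTheory.

Theorem corollary5p3 (X : joinSpace) :
  projective X <-> dense X /\ join_equivalence_relational X.
Proof.
split=> [[pX dX]|[dX jX]]; split=> //.
- move=> a b; split; first exact: preprojective_join_transitive.
  exact: join_symmetric pX.1 a b.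
- exact: join_equivalence_relational_preprojective.
Qed.
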